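(* Let $n$ be even. There is an absolute constant $c>0$ such that on a graph with $3n/2$ vertices there is an initial numbering and a sequence of arc additions keeping the graph acyclic, on which topological search spends at least $cn$ time on each of at least $H(n)$ arc additions, where $H(n)$ is the maximum number of halving intersections of $n$ pseudolines in the plane in general position.
   Context: A set of pseudolines is a set of continuous functions $\mathbb{R}\to\mathbb{R}$ (graphs in the plane) any two of which intersect at most once. It is in general position if no point lies on three or more of them, no two intersection points have the same $x$-coordinate, and every intersection is a crossing (if $P$ is above $Q$ just left of the intersection then $Q$ is above $P$ just right of it). For $n$ even, an intersection is halving if exactly $n/2-1$ of the pseudolines lie below it. Topological search (incremental topological sorting): vertices numbered by a bijection $\mathit{position}$ onto $\{1,\dots,N\}$ ($N$ the number of vertices) with inverse $\mathit{vertex}$, kept topological; adjacency-matrix arc tests. On adding $(v,w)$ with $\mathit{position}(v)>\mathit{position}(w)$: $F=[w]$, $B=[v]$ (queues), $i=\mathit{position}(w)$, $j=\mathit{position}(v)$, $\mathit{vertex}(i)=\mathit{vertex}(j)=$ null; repeat: $i=i+1$, while $i<j$ and no $u\in F$ has an arc to $\mathit{vertex}(i)$, $i=i+1$; if $i=j$ stop, else append $\mathit{vertex}(i)$ to $F$, set it null; $j=j-1$, while $i<j$ and no $z\in B$ has an arc from $\mathit{vertex}(j)$, $j=j-1$; if $i=j$ stop, else append $\mathit{vertex}(j)$ to $B$, set it null. If no arc goes from $F$ to $B$, reorder: while $F$ nonempty: if $\mathit{vertex}(i)\ne$ null and some $u$ currently in $F$ has an arc to it, append it to $F$ and set $\mathit{vertex}(i)=$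 null; if $\mathit{vertex}(i)=$ null, pop $x$ from $F$ and place it at position $i$; $i=i+1$. While $B$ nonempty: $j=j-1$; if $\mathit{vertex}(j)\ne$ null and it has an arc to some $z$ currently in $B$, append it to $B$ and set $\mathit{vertex}(j)=$ null; if $\mathit{vertex}(j)=$ null, pop $y$ from $B$ and place it at position $j$. *)

(* Defs.v *)
From HB Require Import structures.
From mathcomp Require Import all_boot all_order all_algebra.
From mathcomp Require Import all_classical all_reals all_analysis.

Set Implicit Arguments.
Unset Strict Implicit.
Unset Printing Implicit Defensive.

Import Order.TTheory GRing.Theory Num.Theory.
Import numFieldNormedType.Exports.

Section Pseudolines.
Variables (R : realType) (n : nat).
Implicit Types (L : 'I_n -> R -> R) (p q : R * R).
Local Open Scope classical_set_scope.
Local Open Scope ring_scope.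

(* Distinct indices give distinct functions, since a function meets itself
   more than once; so such a family is a set of exactly n pseudolines. *)
Definition pseudolines L :=
  (forall i, continuous (L i)) /\
  (forall i j, i != j ->
     forall x y, L i x = L j x -> L i y = L j y -> x = y).

Definition intersection L : set (R * R) :=
  [set p | exists i j, [/\ i != j, L i p.1 = p.2 & L j p.1 = p.2]].

Definition general_position L :=
  [/\ (forall p i j k, uniq [:: i; j; k] ->
         ~ [/\ L i p.1 = p.2, L j p.1 = p.2 & L k p.1 = p.2]),
      (forall p q, intersection L p -> intersection L q ->
         p.1 = q.1 -> p = q)
    & (forall i j x, i != j -> L i x = L j x ->
         (\forall y \near x^'-, L j y < L i y) ->
         (\forall y \near x^'+, L i y < L j y))].

Definition halving L : set (R * R) :=
  [set p | intersection L p /\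
           #|[pred i | L i p.1 < p.2]| = (n./2 - 1)%N].

Definition halving_count (k : nat) :=
  exists L, [/\ pseudolines L, general_position L & (halving L #= `I_k)%card].

End Pseudolines.

(* Every halving intersection is determined by two of the n pseudolines, so the
   bound 'C(n, 2) on k excludes nothing: see halving_count_le_max_halving. *)
Definition max_halving (R : realType) (n : nat) : nat :=
  \max_(k < 'C(n, 2).+1 | `[< halving_count R n k >]) k.

Lemma halving_count_le (R : realType) (n k : nat) :
  halving_count R n k -> k <= 'C(n, 2).
Proof.
case=> L [[_ once] [three _ _]]; rewrite card_eq_sym => /pcard_eqP/bijPex[f fbij].
pose S (a : 'I_k) := finset (fun i => L i (f a).1 == (f a).2).
have fin (a : 'I_k) : halving L (f a).
  by case: fbij => ff _ _; apply: ff => /=; exact: ltn_ord.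
have S2 a : exists i j, i != j /\ S a = finset.setU (finset.set1 i) (finset.set1 j).
  case: (fin a) => -[i [j [ij Li Lj]]] _; exists i, j; split=> //.
  apply/setP => l; rewrite !inE; apply/idP/idP => [/eqP Ll|/orP[]/eqP->]; last 2 first.
  - exact/eqP.
  - exact/eqP.
  apply/negPn/negP; rewrite negb_or => /andP[li lj].
  by apply: (three (f a) l i j); rewrite /= ?inE ?negb_or ?li ?lj ?ij.
have Sinj : injective S.
  move=> a b Sab; have [i [j [ij Sa]]] := S2 a.
  have mem c l : l \in S c -> L l (f c).1 = (f c).2 by rewrite inE => /eqP.
  have ia : i \in S a by rewrite Sa !inE eqxx.
  have ja : j \in S a by rewrite Sa !inE eqxx orbT.
  have ib : i \in S b by rewrite -Sab.
  have jb : j \in S b by rewrite -Sab.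
  have xy : (f a).1 = (f b).1.
    apply: (once i j ij); first by rewrite (mem _ _ ia) (mem _ _ ja).
    by rewrite (mem _ _ ib) (mem _ _ jb).
  have fab : f a = f b.
    by apply/eqP; rewrite -pair_eqE /= xy -(mem _ _ ia) -(mem _ _ ib) xy !eqxx.
  case: fbij => _ finj _; apply/val_inj/finj => //; rewrite inE; exact: ltn_ord.
rewrite -{1}[k]card_ord -(card_imset predT Sinj) -[n in 'C(n, _)]card_ord.
rewrite -(card_draws _ 2); apply/subset_leq_card/fintype.subsetP => _ /imsetP[a _ ->].
by have [i [j [ij ->]]] := S2 a; rewrite inE cards2 ij.
Qed.

Lemma halving_count_le_max_halving (R : realType) (n k : nat) :
  halving_count R n k -> k <= max_halving R n.
Proof.
move=> nk; have kC : k < 'C(n, 2).+1 by rewrite ltnS (halving_count_le nk).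
by apply: (leq_bigmax_cond (Ordinal kC)); exact/asboolP.
Qed.

Section TopologicalSearch.
Variable V : finType.

Definition numbering (pos : V -> nat) :=
  injective pos /\ forall k, (exists v, pos v = k) <-> 0 < k <= #|V|.

(* [vertex k] is [None] when the k-th cell is null, or k is out of range. *)
Record state := State { position : V -> nat; vertex : nat -> option V }.

Definition initial_state (pos : V -> nat) : state :=
  State pos (fun k => [pick v | pos v == k]).

Definition nullify (vtx : nat -> option V) (i : nat) : nat -> option V :=
  [eta vtx with i |-> None].

Definition place (st : state) (i : nat) (x : V) : state :=
  State [eta position st with x |-> i] [eta vertex st with i |-> Some x].

(* The time of a procedure is the number of loop iterations (moves of i or j)
   plus the number of arc tests; the remaining work is constant per iteration.
   [tests a s] counts the tests made by a scan of s for an item satisfying a,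
   stopping at the first success. *)
Definition tests (T : Type) (a : pred T) (s : seq T) : nat :=
  minn (find a s).+1 (size s).

Section Addition.
Variable e : rel V.

Definition arc_from (F : seq V) (o : option V) : bool :=
  if o is Some x then has (fun u => e u x) F else false.
Definition arc_from_tests (F : seq V) (o : option V) : nat :=
  if o is Some x then tests (fun u => e u x) F else 0.

Definition arc_to (B : seq V) (o : option V) : bool :=
  if o is Some x then has (fun z => e x z) B else false.
Definition arc_to_tests (B : seq V) (o : option V) : nat :=
  if o is Some x then tests (fun z => e x z) B else 0.

(* The inner while loops; d is j - i, so d = 0 means i = j. The results are the
   final index (i, respectively j) and the time. *)
Fixpoint scan_up (vtx : nat -> option V) (F : seq V) (d i : nat) : nat * nat :=
  if d is d'.+1 then
    if arc_from F (vtx i) then (i, arc_from_tests F (vtx i))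
    else let: (i', t) := scan_up vtx F d' i.+1 in
         (i', (arc_from_tests F (vtx i) + t).+1)
  else (i, 0).

Fixpoint scan_down (vtx : nat -> option V) (B : seq V) (d j : nat) : nat * nat :=
  if d is d'.+1 then
    if arc_to B (vtx j) then (j, arc_to_tests B (vtx j))
    else let: (j', t) := scan_down vtx B d' j.-1 in
         (j', (arc_to_tests B (vtx j) + t).+1)
  else (j, 0).

(* The result is (vtx, F, B, the common final value of i and j, time). Each
   round shrinks j - i, so [fuel = j - i] never runs out. *)
Fixpoint search (fuel : nat) (vtx : nat -> option V) (F B : seq V) (i j : nat) :
    (nat -> option V) * seq V * seq V * nat * nat :=
  if fuel is fuel'.+1 then
    let: (i1, t1) := scan_up vtx F (j - i.+1) i.+1 in
    if i1 == j then (vtx, F, B, j, t1.+1) else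
    let F1 := F ++ seq_of_opt (vtx i1) in
    let vtx1 := nullify vtx i1 in
    let: (j1, t2) := scan_down vtx1 B (j.-1 - i1) j.-1 in
    if i1 == j1 then (vtx1, F1, B, i1, t1.+1 + t2.+1) else
    let B1 := B ++ seq_of_opt (vtx1 j1) in
    let vtx2 := nullify vtx1 j1 in
    let: (vtx3, F3, B3, m, t3) := search fuel' vtx2 F1 B1 i1 j1 in
    (vtx3, F3, B3, m, t1.+1 + t2.+1 + t3)
  else (vtx, F, B, i, 0).

(* The two reordering loops, over the list of positions still to be visited. *)
Fixpoint reorder_up (ps : seq nat) (st : state) (F : seq V) : state * nat :=
  match F, ps with
  | _ :: _, i :: ps' =>
    let o := vertex st i in
    let hit := arc_from F o in
    let F1 := if hit then F ++ seq_of_opt o else F in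
    let: (st1, F2) :=
      if hit || (o == None) then
        if F1 is x :: F' then (place st i x, F') else (st, F1)
      else (st, F1) in
    let: (st2, t) := reorder_up ps' st1 F2 in
    (st2, (arc_from_tests F o + t).+1)
  | _, _ => (st, 0)
  end.

Fixpoint reorder_down (ps : seq nat) (st : state) (B : seq V) : state * nat :=
  match B, ps with
  | _ :: _, j :: ps' =>
    let o := vertex st j in
    let hit := arc_to B o in
    let B1 := if hit then B ++ seq_of_opt o else B in
    let: (st1, B2) :=
      if hit || (o == None) then
        if B1 is y :: B' then (place st j y, B') else (st, B1)
      else (st, B1) in
    let: (st2, t) := reorder_down ps' st1 B2 in
    (st2, (arc_to_tests B o + t).+1)
  | _, _ => (st, 0)
  end.

(* The state is [None] when an arc from F to B, hence a cycle, is found. *)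
Definition topological_search (st : state) (v w : V) : option state * nat :=
  if position st v <= position st w then (Some st, 1) else
  let i := position st w in
  let j := position st v in
  let vtx0 := nullify (nullify (vertex st) i) j in
  let: (vtx, F, B, m, t1) := search (j - i) vtx0 [:: w] [:: v] i j in
  let FB := [seq (u, z) | u <- F, z <- B] in
  let t2 := tests (fun a => e a.1 a.2) FB in
  if has (fun a => e a.1 a.2) FB then (None, (t1 + t2).+1) else
  let: (st1, t3) :=
    reorder_up (iota m (#|V|.+1 - m)) (State (position st) vtx) F in
  let: (st2, t4) := reorder_down (rev (iota 1 m.-1)) st1 B in
  (Some st2, (t1 + t2 + t3 + t4).+1).

End Addition.

Definition adjacency (E : seq (V * V)) : rel V := [rel x y | (x, y) \in E].

Definition acyclic (E : seq (V * V)) :=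
  forall p, p != [::] -> ~~ cycle (adjacency E) p.

(* Times of the successive additions of [arcs] to the graph with arc list E;
   the run ends at the first addition that creates a cycle. *)
Fixpoint addition_times (E : seq (V * V)) (st : state) (arcs : seq (V * V)) :
    seq nat :=
  if arcs is (v, w) :: arcs' then
    let E' := rcons E (v, w) in
    let: (ost, t) := topological_search (adjacency E') st v w in
    t :: (if ost is Some st' then addition_times E' st' arcs' else [::])
  else [::].

End TopologicalSearch.

(* Main.v *)
(* Sweep a vertical line from left to right across a family of n pseudolines
   with the maximum number of halving intersections. Give each pseudoline a
   vertex, numbered by its height on the sweep line, with n/2 further isolated
   vertices in the middle of the numbering. When v, just above w before a
   crossing, passes below it, add the arc (v, w). All vertices between w and v
   are isolated, so the search scans every one of them, ends with F = [w] and
   B = [v], and merely exchanges v and w; the numbering thus keeps following the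
   sweep line. At a halving crossing the n/2 isolated vertices lie between w and
   v. All arcs point upwards on the far right of the plane, so no cycle arises. *)
Require Import Defs.
From mathcomp Require Import all_boot all_order all_algebra.
From mathcomp Require Import all_classical all_reals all_analysis.
From mathcomp Require Import perm zify lra.
Import Order.TTheory GRing.Theory Num.Theory.
Import numFieldNormedType.Exports.

Set Implicit Arguments.
Unset Strict Implicit.

(** * Arc additions that merely exchange two vertices *)

Section Search.
Variable V : finType.
Implicit Types (e : rel V) (st : state V) (v w x : V) (pos : V -> nat).

(** Pigeonhole: shifted down by one, [pos] is an injection into the ordinals below [#|V|], hence
    onto. *)
Lemma inj_numbering pos :
  injective pos -> (forall x, 0 < pos x <= #|V|) -> numbering pos.
Proof.
move=> pos_inj pos_bnd; split=> // k; split=> [[x <-]//|/andP[k0 kV]].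
have predV x : (pos x).-1 < #|V| by have := pos_bnd x; lia.
pose f x := Ordinal (predV x).
have f_inj : injective f.
  move=> x y /(congr1 val)/= xy; apply: pos_inj.
  by have := pos_bnd x; have := pos_bnd y; lia.
have kV' : k.-1 < #|V| by lia.
have /(_ (Ordinal kV'))/codomP[x] : forall y, y \in codom f.
  by move=> y; apply: inj_card_onto => //; rewrite card_ord.
by move=> /(congr1 val)/= kx; exists x; have := pos_bnd x; lia.
Qed.

(** The equivalence ranges over all [k], so exactly the cells outside 1, ..., [#|V|] are null. *)
Definition consistent st :=
  numbering (position st) /\
  forall k x, vertex st k = Some x <-> position st x = k.

Lemma initial_state_consistent pos :
  numbering pos -> consistent (initial_state pos).
Proof.
move=> npos; split=> //= k x; case: pickP => [y /eqP yk|none].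
  split=> [[<-]//|xk]; congr Some; apply: npos.1; congruence.
by split=> // xk; have := none x; rewrite xk eqxx.
Qed.

(** Each move that meets no arc costs at least one unit, and only the exhaustion of [d] ends the
    scan. The lower bound on the search time comes from here. *)
Lemma scan_up_idle e vtx F d i :
  (forall k, i <= k < i + d -> arc_from e F (vtx k) = false) ->
  exists2 t, d <= t & scan_up e vtx F d i = (i + d, t).
Proof.
elim: d i => [|d IH] i idle /=; first by exists 0; rewrite ?addn0.
have [|t dt ->] := IH i.+1; first by move=> k kd; apply: idle; lia.
rewrite idle; last lia.
by exists (arc_from_tests e F (vtx i) + t).+1; [lia|rewrite addSnnS].
Qed.

Lemma reorder_up_null e i ps st w :
  vertex st i = None -> (reorder_up e (i :: ps) st [:: w]).1 = place st i w.
Proof. by move=> /= ->; case: ps. Qed.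

(** The cells of [pre] are occupied and have no arc to [v], so they are passed over; placing [v] in
    the null cell [i] empties the queue, which ends the loop before [post]. *)
Lemma reorder_down_null e pre i post st v :
  (forall k, k \in pre ->
     vertex st k != None /\ arc_to e [:: v] (vertex st k) = false) ->
  vertex st i = None ->
  (reorder_down e (pre ++ i :: post) st [:: v]).1 = place st i v.
Proof.
move=> + sti; elim: pre => [_|k pre IH idle].
  by rewrite /= sti /=; case: post.
have [/negPf kN kidle] := idle k (mem_head _ _).
rewrite /= kidle kN /=.
have {}IH := IH (fun l lpre => idle l (mem_behead (s := k :: pre) lpre)).
by move: IH; case: (reorder_down _ _ _ _).
Qed.

Lemma numbering_tperm pos v w :
  numbering pos -> numbering (pos \o tperm v w).
Proof.
move=> [pos_inj pos_onto]; split; first exact: inj_comp pos_inj perm_inj.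
move=> k; rewrite -pos_onto; split=> -[x <-]; first by exists (tperm v w x).
by exists (tperm v w x); rewrite /= tpermK.
Qed.

(** No arc leads from [w] into the gap, so the first upward scan crosses all of it before [B] can
    grow; the final move onto the position of [v] supplies the last unit of time. Reordering then
    drops [w] and [v] into each other's null cells, since no vertex of the gap has an arc to [v]. *)
Lemma topological_search_swap e st v w :
  consistent st -> position st w < position st v -> e w v = false ->
  (forall x, position st w < position st x < position st v ->
     e w x = false /\ e x v = false) ->
  exists st' t, [/\ topological_search e st v w = (Some st', t),
    consistent st', position st' =1 position st \o tperm v w &
    position st v - position st w <= t].
Proof.
move=> [npos vtxP] wv ewv between.
rewrite /topological_search leqNgt wv /=.
set i := position st w in wv between *; set j := position st v in wv between *.
have vw : v == w = false by apply/eqP => E; move: wv; rewrite /i /j E ltnn.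
have /andP[i0 iV] : 0 < i <= #|V| by apply/npos.2; exists w.
have /andP[j0 jV] : 0 < j <= #|V| by apply/npos.2; exists v.
set vtx0 := nullify _ j.
have vtx0E k : i < k < j -> vtx0 k = vertex st k.
  by move=> kij; rewrite /vtx0 /nullify /= !ifN //; lia.
have vtx_some k : i < k < j -> exists2 x, vertex st k = Some x & position st x = k.
  move=> kij; have [|x xk] := (npos.2 k).2; first lia.
  by exists x => //; apply/vtxP.
have [|t1 dt1 scanE] := @scan_up_idle e vtx0 [:: w] (j - i.+1) i.+1.
  move=> k kij; have {}kij : i < k < j by lia.
  rewrite vtx0E //; have [x -> xk] := vtx_some _ kij.
  by rewrite /= orbF; apply: (between x _).1; rewrite xk.
(* One round suffices: the upward scan returns [j] itself, which stops the search. *)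
have -> : search e (j - i) vtx0 [:: w] [:: v] i j = (vtx0, [:: w], [:: v], j, t1.+1).
  have -> : j - i = (j - i).-1.+1 by lia.
  by rewrite [search _ _ _ _ _ _ _]/= scanE subnKC // eqxx.
set FB := [seq _ | _ <- _, _ <- _]; have -> : has (fun a => e a.1 a.2) FB = false by rewrite /FB /= ewv.
have -> : iota j (#|V|.+1 - j) = j :: iota j.+1 (#|V| - j) by rewrite subSn.
(* Downwards from [j], the gap comes first, then the null cell [i]. *)
have -> : rev (iota 1 j.-1) =
    rev (iota i.+1 (j - i.+1)) ++ i :: rev (iota 1 i.-1).
  have -> : j.-1 = i.-1 + (1 + (j - i.+1)) by lia.
  rewrite !iotaD !rev_cat /= add1n prednK // addn1 /= -catA; congr (_ ++ _).
have vtx0j : vtx0 j = None by rewrite /vtx0 /nullify /= eqxx.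
have := @reorder_up_null e j (iota j.+1 (#|V| - j)) (State (position st) vtx0) w vtx0j.
case: (reorder_up _ _ _ _) => [st1 t3]; rewrite [LHS]/= => ->; set st2 := place _ _ _.
have st2i : vertex st2 i = None.
  by rewrite /st2 /place /= /vtx0 /nullify /= ltn_eqF // eqxx.
have := @reorder_down_null e (rev (iota i.+1 (j - i.+1))) i (rev (iota 1 i.-1)) st2 v.
move=> /(_ _ st2i).
case: (reorder_down _ _ _ _) => [st3 t4]; rewrite [LHS]/= => -> => [|k]; last first.
  rewrite mem_rev mem_iota => kij; have {}kij : i < k < j by lia.
  rewrite /st2 /place /= ltn_eqF ?vtx0E //; last by case/andP: kij.
  have [x -> xk] := vtx_some _ kij; split=> //=; rewrite orbF.
  by apply: (between x _).2; rewrite xk.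
have posE : position (place st2 i v) =1 position st \o tperm v w.
  move=> x; rewrite /= /st2 /place /=.
  case: tpermP => [->|->|/eqP/negPf-> /eqP/negPf->] //; first by rewrite eqxx.
  by rewrite eq_sym vw eqxx.
exists (place st2 i v); eexists; split; [by []| |exact: posE|lia].
have npos' := numbering_tperm v w npos.
split; first by rewrite (funext posE).
move=> k x; rewrite posE /place /= /vtx0 /nullify /=.
have [->|ki] := eqVneq k i.
  split=> [[<-]|xi]; first by rewrite tpermL.
  by congr Some; apply: npos'.1; rewrite /= tpermL.
have [->|kj] := eqVneq k j.
  split=> [[<-]|xj]; first by rewrite tpermR.
  by congr Some; apply: npos'.1; rewrite /= tpermR.
rewrite vtxP.
case: tpermP => [->|->|//]; split=> xk; move: ki kj; rewrite -xk ?eqxx //.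
Qed.

(** Around a cycle [f] would increase strictly and yet return to its starting value. *)
Lemma acyclic_pos (f : V -> nat) (E : seq (V * V)) :
  (forall v w, (v, w) \in E -> f v < f w) -> acyclic E.
Proof.
move=> Elt [//|x p] _; apply/negP => /= xp.
have {xp} : path (relpre f ltn) x (rcons p x).
  by apply: sub_path xp => v w /=; exact: Elt.
move=> /(order_path_min (fun y x z => @ltn_trans (f y) (f x) (f z))).
by move=> /allP/(_ x); rewrite mem_rcons mem_head /= ltnn => /(_ isT).
Qed.

End Search.

(** * The vertical order of pseudolines along a sweep *)

Local Open Scope classical_set_scope.
Local Open Scope ring_scope.

(** By the intermediate value theorem, [g - f] cannot change sign without a zero. *)
Lemma lt_of_disjoint (R : realType) (f g : R -> R) (a b : R) :
  continuous f -> continuous g -> a <= b ->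
  (forall y, a <= y <= b -> f y <> g y) -> (f a < g a) = (f b < g b).
Proof.
move=> cf cg ab fg.
have cgf : continuous (fun y => g y - f y).
  by move=> y; apply: cvgB; [exact: cg|exact: cf].
apply/idP/idP => lt; rewrite ltNge le_eqVlt; apply/negP => /orP[/eqP/esym|lt'].
1,3: by apply: fg; rewrite ab lexx.
all: have [|c] := IVT (v := 0) ab (continuous_subspaceT cgf).
1,3: by rewrite ge_min le_max !subr_ge0 !subr_le0 (ltW lt) (ltW lt') orbT.
all: by rewrite in_itv /= => /fg fgc /subr0_eq/esym.
Qed.

Section Crossings.
Variables (R : realType) (n : nat) (L : 'I_n -> R -> R).
Hypotheses (psL : pseudolines L) (gpL : general_position L).
Implicit Types (i j : 'I_n) (p q : 'I_n * 'I_n) (s x y : R).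

(** The pair is ordered with the line that comes from above first, as in the arc to be added. The
    order is prescribed on whole half-lines, which [meet_crosses] derives from the local
    condition. *)
Definition crosses p x :=
  [/\ L p.1 x = L p.2 x, (forall y, y < x -> L p.2 y < L p.1 y) &
      (forall y, x < y -> L p.1 y < L p.2 y)].

(** Two lines that meet at [x] meet nowhere else, so by [lt_of_disjoint] their order is constant on
    each side of [x]; general position makes it flip there. *)
Lemma meet_crosses i j x :
  i != j -> L i x = L j x -> crosses (i, j) x \/ crosses (j, i) x.
Proof.
move: psL gpL => [cL once] [_ _ cross].
(* A tie at [x - 1] would be a second meeting point. *)
wlog above : i j / L j (x - 1) < L i (x - 1) => [hw ij Lij|ij Lij].
  have [lt|lt|eqx] := ltgtP (L i (x - 1)) (L j (x - 1)).
  - by have := hw j i lt; rewrite eq_sym ij => /(_ isT (esym Lij)) []; [right|left].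
  - exact: hw.
  - by have := once i j ij _ _ Lij eqx; lra.
have apart y : y != x -> L i y <> L j y.
  by move=> /eqP yx Ly; apply: yx; apply: once ij _ _ Ly Lij.
have below y : y < x -> L j y < L i y.
  move=> yx; have [ly|ly] := leP y (x - 1).
    rewrite (@lt_of_disjoint _ _ _ y (x - 1)) // => z zy E.
    by apply: (apart z); [lra|rewrite E].
  rewrite -(@lt_of_disjoint _ _ _ (x - 1) y) ?ltW // => z zy E.
  by apply: (apart z); [lra|rewrite E].
left; split=> //= y xy.
have {}cross := cross i j x ij Lij.
have /cross ij_right : \forall y \near x^'-, L j y < L i y.
  by near=> z; apply: below; near: z; exact: nbhs_left_lt.
(* The local flip gives one point [z] between [x] and [y]; from there the order extends to [y]. *)
have [z [zx zy Lz]] : exists z, [/\ x < z, z < y & L i z < L j z].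
  near (x^'+) => z; exists z; split; near: z => //.
  - exact: nbhs_right_gt.
  - exact: nbhs_right_lt.
rewrite -(@lt_of_disjoint _ _ _ z y) ?ltW // => t ty.
by apply: apart; lra.
Unshelve. all: by end_near. Qed.

Definition crossing p := `[< exists x, crosses p x >].
(** The default 0 is a filler for pairs that do not cross. *)
Definition abscissa p := xget 0 [set x | crosses p x]%classic.

Lemma crossingP p : crossing p -> crosses p (abscissa p).
Proof.
by move=> /asboolP[x px]; have := @xgetI _ 0 [set x | crosses p x]%classic x px.
Qed.

Lemma crosses_neq p x : crosses p x -> p.1 != p.2.
Proof.
case=> _ /(_ (x - 1)) lt _; apply/eqP => E; move: lt; rewrite E ltxx.
have xx : x - 1 < x by lra.
by move=> /(_ xx).
Qed.

Lemma crosses_abscissa p x : crosses p x -> crossing p /\ abscissa p = x.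
Proof.
move=> px; have cp : crossing p by apply/asboolP; exists x.
split=> //; have [Lp _ _] := crossingP cp; have [Lx _ _] := px.
by apply: psL.2 (crosses_neq px) _ _ Lp Lx.
Qed.

Lemma meet_crossing i j x : i != j -> L i x = L j x ->
  exists p, [/\ crossing p, abscissa p = x & p = (i, j) \/ p = (j, i)].
Proof.
move=> ij Lij; case: (meet_crosses ij Lij) => /crosses_abscissa[cp px].
  by exists (i, j); split=> //; left.
by exists (j, i); split=> //; right.
Qed.

(** Both crossings would occur at the only meeting point, and left of it each line would be above
    the other. *)
Lemma crossing_asym i j : crossing (i, j) -> ~~ crossing (j, i).
Proof.
move=> cij; apply/negP => cji.
have [L1 lt1 _] := crossingP cij; have [L2 lt2 _] := crossingP cji.
have ij : i != j := crosses_neq (crossingP cij).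
have E : abscissa (j, i) = abscissa (i, j) := psL.2 _ _ ij _ _ (esym L2) L1.
have := lt1 (abscissa (i, j) - 1); have := lt2 (abscissa (i, j) - 1).
rewrite E /=; set y := _ - 1.
have yx : y < abscissa (i, j) by rewrite /y; lra.
by move=> /(_ yx) lt /(_ yx); rewrite ltNge (ltW lt).
Qed.

(** Equal abscissas force the same point, and then the same unordered pair, as no three lines share
    a point; [crossing_asym] settles the order. *)
Lemma abscissa_inj p q :
  crossing p -> crossing q -> abscissa p = abscissa q -> p = q.
Proof.
move: p q => [a b] [c d] cp cq E.
have [/= L1 _ _] := crossingP cp; have [/= L2 _ _] := crossingP cq.
have /= ab := crosses_neq (crossingP cp); have /= cd := crosses_neq (crossingP cq).
set x := abscissa (a, b) in E L1; rewrite -E in L2.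
move: gpL => [three same _].
have Ey : L a x = L c x.
  have I1 : intersection L (x, L a x) by exists a, b; rewrite /= -L1.
  have I2 : intersection L (x, L c x) by exists c, d; rewrite /= -L2.
  by case: (same _ _ I1 I2 erefl).
have mem k : L k x = L a x -> k = a \/ k = b.
  move=> Lk; have [->|ka] := eqVneq k a; first by left.
  have [->|kb] := eqVneq k b; first by right.
  by case: (three (x, L a x) k a b); rewrite /= ?inE ?negb_or ?ka ?kb ?ab.
have [ca|cb] := mem c (esym Ey); have [da|db] := mem d (etrans (esym L2) (esym Ey)).
- by rewrite ca da eqxx in cd.
- by rewrite ca db.
- by move: cq; rewrite cb da => cq; have := crossing_asym cq; rewrite cp.
- by rewrite cb db eqxx in cd.
Qed.

Definition generic s := forall i j, i != j -> L i s <> L j s.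

Lemma generic_abscissa s : (forall p, crossing p -> abscissa p != s) -> generic s.
Proof.
by move=> gen i j ij /(meet_crossing ij)[p [cp ps _]]; move: (gen p cp); rewrite ps eqxx.
Qed.

Definition rank s i := #|[pred j | L j s < L i s]|.

Lemma rank_bound s i : (rank s i < n)%N.
Proof.
rewrite -[n]card_ord [X in (_ < X)%N](cardD1 i) /= add1n ltnS.
apply: subset_leq_card; apply/fintype.subsetP => j; rewrite !inE andbT => lt.
by apply/eqP => E; rewrite E ltxx in lt.
Qed.

Lemma ltn_rank s i j : L i s < L j s -> (rank s i < rank s j)%N.
Proof.
move=> lt; apply: proper_card; apply/fintype.properP; split.
  by apply/fintype.subsetP => k; rewrite !inE => /lt_trans; apply.
by exists i; rewrite !inE ?ltxx.
Qed.

Lemma rank_inj s : generic s -> injective (rank s).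
Proof.
move=> gen i j E; apply/eqP/negPn/negP => ij; have := gen i j ij.
by case: (ltgtP (L i s) (L j s)) => // /ltn_rank; rewrite E ltnn.
Qed.

(* Apart from a and b, the lines below a or below b at s are those below the
   point where a and b meet; in [rank_swap], s is a time just before or after. *)
Lemma rank_near s x a b : a != b -> L a x = L b x -> L a s < L b s ->
  (forall c d, c != a -> c != b -> d = a \/ d = b ->
     (L c s < L d s) = (L c x < L d x)) ->
  rank s a = rank x a /\ rank s b = (rank x a).+1.
Proof.
move=> ab Lx lt same; split.
  apply: eq_card => c; rewrite !inE.
  have [->|ca] := eqVneq c a; first by rewrite !ltxx.
  have [->|cb] := eqVneq c b; first by rewrite Lx ltxx ltNge (ltW lt).
  by apply: same => //; left.
rewrite [LHS](cardD1 a) inE lt add1n; congr _.+1; apply: eq_card => c; rewrite !inE.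
have [->|ca] /= := eqVneq c a; first by rewrite ltxx.
have [->|cb] := eqVneq c b; first by rewrite Lx !ltxx.
by rewrite Lx; apply: same => //; right.
Qed.

(** On [[s, s']] all pairs of lines but that of [p] keep their order, since a meeting would be
    another crossing. Applied on each side, [rank_near] relates the ranks at [s] and [s'] to those
    at the meeting point. *)
Lemma rank_swap s s' p : crossing p -> s < abscissa p < s' ->
  (forall q, crossing q -> s <= abscissa q <= s' -> q = p) ->
  [/\ rank s p.2 = rank (abscissa p) p.1, rank s p.1 = (rank s p.2).+1,
      rank s' p.1 = rank s p.2, rank s' p.2 = rank s p.1 &
      forall c, c != p.1 -> c != p.2 -> rank s' c = rank s c].
Proof.
case: p => v w cp /andP[]; set x := abscissa _ => sx xs' only /=.
have [/= Lx lt_s lt_s'] := crossingP cp; have /= vw := crosses_neq (crossingP cp).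
have cL := psL.1.
have disj c d y : c != d -> (c, d) <> (v, w) -> (d, c) <> (v, w) ->
    s <= y <= s' -> L c y <> L d y.
  move=> cd n1 n2 ys /(meet_crossing cd)[q [cq qy [E|E]]].
    by apply: n1; rewrite -E; apply: only => //; rewrite qy.
  by apply: n2; rewrite -E; apply: only => //; rewrite qy.
have same_s c d : c != v -> c != w -> d = v \/ d = w ->
    (L c s < L d s) = (L c x < L d x).
  move=> cv cw dvw; apply: lt_of_disjoint => //; first exact: ltW.
  move=> y ys; apply: disj; last lra.
  - by case: dvw => ->.
  - by case=> /eqP; rewrite (negPf cv).
  - by case=> _ /eqP; rewrite (negPf cw).
have same_s' c d : c != v -> c != w -> d = v \/ d = w ->
    (L c s' < L d s') = (L c x < L d x).
  move=> cv cw dvw; apply/esym/lt_of_disjoint => //; first exact: ltW.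
  move=> y ys; apply: disj; last lra.
  - by case: dvw => ->.
  - by case=> /eqP; rewrite (negPf cv).
  - by case=> _ /eqP; rewrite (negPf cw).
(* The lower line is [w] at [s] and [v] at [s'], so the two uses exchange their roles. *)
have [||rw rv] := rank_near (_ : w != v) (esym Lx) (lt_s s sx).
- by rewrite eq_sym.
- by move=> c d cw cv dwv; apply: same_s => //; tauto.
have [rv' rw'] := rank_near vw Lx (lt_s' s' xs') same_s'.
have rvw : rank x v = rank x w by rewrite /rank Lx.
rewrite rw rv rv' rw' rvw; split=> // c cv cw.
apply: eq_card => d; rewrite !inE.
have [->|dc] := eqVneq d c; first by rewrite !ltxx.
apply/esym/lt_of_disjoint => //; first by lra.
move=> y ys; apply: disj => //.
- by case=> _ /eqP; rewrite (negPf cw).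
- by case=> /eqP; rewrite (negPf cv).
Qed.

End Crossings.

(** The maximum is an attained count or the base value 0 of [\max], for which no family is at
    hand. *)
Lemma halving_count_max (R : realType) n :
  max_halving R n = 0%N \/ halving_count R n (max_halving R n).
Proof.
rewrite /max_halving; elim/big_ind: _ => [|a b|k /asboolP nk]; [by left| |by right].
by rewrite /maxn; case: ifP.
Qed.

(** * The sweep as a sequence of arc additions *)

Section Run.
Variables (R : realType) (n : nat) (L : 'I_n -> R -> R).
Hypotheses (psL : pseudolines L) (gpL : general_position L) (even_n : ~~ odd n).
Implicit Types (p q : 'I_n * 'I_n) (s : R).
Notation V := 'I_(3 * n %/ 2).

Lemma lines_fit : (n <= 3 * n %/ 2)%N. Proof. lia. Qed.

Definition line_vertex (i : 'I_n) : V := widen_ord lines_fit i.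

Lemma line_vertex_inj : injective line_vertex.
Proof. by move=> i j /(congr1 val)/= ij; apply: val_inj. Qed.

(* The n/2 vertices numbered from n on belong to no line; they stay in the
   middle positions n/2 + 1, ..., n and never get an arc. *)
Definition slot (r : nat) : nat := if (r < n./2)%N then r.+1 else (r + n./2).+1.

Definition sweep_position s (x : V) : nat :=
  if insub (val x) is Some i then slot (rank L s i) else (x - n./2).+1.

Lemma sweep_position_line s i :
  sweep_position s (line_vertex i) = slot (rank L s i).
Proof. by rewrite /sweep_position valK. Qed.

Lemma sweep_position_middle s (x : V) :
  (n <= x)%N -> sweep_position s x = (x - n./2).+1.
Proof. by move=> nx; rewrite /sweep_position insubN // -leqNgt. Qed.

Variant vertex_spec : V -> Prop :=
| VertexLine i : vertex_spec (line_vertex i)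
| VertexMiddle (x : V) of (n <= x)%N : vertex_spec x.

Lemma vertexP x : vertex_spec x.
Proof.
have [xn|nx] := ltnP x n; last exact: VertexMiddle.
have -> : x = line_vertex (Ordinal xn) by apply: val_inj.
exact: VertexLine.
Qed.

(** Distinct ranks separate the lines, and their slots avoid the block n/2 + 1, ..., n, which the
    middle vertices fill. *)
Lemma sweep_numbering s : generic L s -> numbering (sweep_position s).
Proof.
move=> gen; apply: inj_numbering => [x y|x].
  case: (vertexP x) (vertexP y) => [i|{}x nx] [j|{}y ny].
  - rewrite !sweep_position_line => ij; congr line_vertex.
    by apply: (rank_inj gen); move: ij; rewrite /slot; do 2!case: ifP; lia.
  - rewrite sweep_position_line sweep_position_middle //.
    by have := ltn_ord y; rewrite /slot; case: ifP; lia.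
  - rewrite sweep_position_line sweep_position_middle //.
    by have := ltn_ord x; rewrite /slot; case: ifP; lia.
  - by rewrite !sweep_position_middle // => E; apply: ord_inj; lia.
rewrite card_ord; case: (vertexP x) => [i|{}x nx].
  by rewrite sweep_position_line; have := rank_bound L s i; rewrite /slot; case: ifP; lia.
by rewrite sweep_position_middle //; have := ltn_ord x; lia.
Qed.

Definition arc p : V * V := (line_vertex p.1, line_vertex p.2).

Lemma arc_inj : injective arc.
Proof. by move=> [a b] [c d] [/ord_inj-> /ord_inj->]. Qed.

(** At the crossing itself [p.1] and [p.2] tie, so neither is counted, in agreement with
    [halving]. *)
Definition halving_crossing p := rank L (abscissa L p) p.1 == (n./2 - 1)%N.

Lemma sweep_swap s s' p : crossing L p -> s < abscissa L p < s' ->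
  (forall q, crossing L q -> s <= abscissa L q <= s' -> q = p) ->
  sweep_position s' =1
  sweep_position s \o tperm (line_vertex p.1) (line_vertex p.2).
Proof.
move=> cp sps' only x /=; have [_ _ r1 r2 r3] := rank_swap psL gpL cp sps' only.
case: tpermP => [->|->|].
- by rewrite !sweep_position_line r1.
- by rewrite !sweep_position_line r2.
case: (vertexP x) => [i|{}x nx n1 n2]; last by rewrite !sweep_position_middle.
by move=> n1 n2; rewrite !sweep_position_line r3 //;
  apply/eqP => E; [apply: n1|apply: n2]; rewrite E.
Qed.

(** Just before the crossing the two ranks are consecutive, so only middle vertices can lie between
    and [topological_search_swap] applies. *)
Lemma topological_search_crossing (e : rel V) st s s' p :
  crossing L p -> s < abscissa L p < s' ->
  (forall q, crossing L q -> s <= abscissa L q <= s' -> q = p) ->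
  consistent st -> position st =1 sweep_position s ->
  (forall x y, e x y -> exists2 q, crossing L q & (x, y) = arc q) ->
  exists st' t,
    [/\ topological_search e st (line_vertex p.1) (line_vertex p.2) = (Some st', t),
        consistent st', position st' =1 sweep_position s' &
        halving_crossing p -> (n <= 2 * t)%N].
Proof.
move=> cp sps' only cst posst earc.
have [rx r12 _ _ _] := rank_swap psL gpL cp sps' only.
have no_arc (x y : V) : ((n <= x) || (n <= y))%N -> e x y = false.
  move=> xy; apply/negP => /earc[[a b] _ [ax ay]]; move: xy.
  by rewrite ax ay /= leqNgt ltn_ord leqNgt ltn_ord.
have [|||st' [t [search_eq cst' pos' dt]]] :=
  @topological_search_swap _ e st (line_vertex p.1) (line_vertex p.2) cst.
- by rewrite !posst !sweep_position_line r12 /slot; do 2!case: ifP; lia.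
(* An arc from the lower to the upper vertex would come from a crossing of the reversed pair. *)
- apply/negP => /earc[[a b] cab [/ord_inj E2 /ord_inj E1]].
  have := crossing_asym psL cp; case: (p) E1 E2 cp => c d /= -> -> _.
  by rewrite cab.
- move=> x; rewrite !posst !sweep_position_line r12.
  case: (vertexP x) => [i|{}x nx]; last by rewrite !no_arc ?nx ?orbT.
  by rewrite sweep_position_line /slot; do 3!case: ifP; lia.
exists st', t; split=> //.
  by move=> x; rewrite pos' (sweep_swap cp sps' only) /= posst.
(* With lower rank n/2 - 1 the two slots are n/2 and n + 1, at distance n/2 + 1. *)
rewrite /halving_crossing -rx => /eqP rE; move: dt.
rewrite !posst !sweep_position_line r12 rE /slot.
by have := rank_bound L s p.1; do 2!case: ifP; lia.
Qed.

(** Induction along the sweep: [ps] holds the crossings right of [s], and the state is the numbering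
    at [s]. *)
Lemma addition_times_crossings ps s E st :
  sorted (fun p q => abscissa L p < abscissa L q) ps ->
  (forall p, (p \in ps) = crossing L p && (s < abscissa L p)) ->
  (forall p, crossing L p -> abscissa L p != s) ->
  consistent st -> position st =1 sweep_position s ->
  (forall a, a \in E -> exists2 p, crossing L p & a = arc p) ->
  (count halving_crossing ps <=
   count (fun t => n <= 2 * t) (addition_times E st (map arc ps)))%N.
Proof.
elim: ps s E st => [//|p ps IH] s E st srt psE sgen cst posst Earc.
have /andP[cp sp] : crossing L p && (s < abscissa L p) by rewrite -psE mem_head.
have abscissa_trans : transitive (fun p q => abscissa L p < abscissa L q).
  by move=> a b c; exact: lt_trans.
have /allP p_lt := order_path_min abscissa_trans srt.
(* The next sweep line is midway to the next crossing, or one unit beyond the last. *)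
have [s' ps' s'ps] : exists2 s', abscissa L p < s' & forall q, q \in ps -> s' < abscissa L q.
  case: ps {IH psE} srt p_lt => [_ _|q ps /= /andP[pq srt] p_lt].
    by exists (abscissa L p + 1) => //; rewrite ltrDl.
  exists ((abscissa L p + abscissa L q) / 2); first lra.
  move=> r; rewrite inE => /orP[/eqP->|rps]; first lra.
  have /allP/(_ r rps) := order_path_min abscissa_trans srt.
  lra.
have only q : crossing L q -> s <= abscissa L q <= s' -> q = p.
  move=> cq /andP[sq qs']; have : q \in p :: ps.
    by rewrite psE cq lt_neqAle eq_sym sgen.
  by rewrite inE => /orP[/eqP//|/s'ps]; rewrite ltNge qs'.
have E'arc a : a \in rcons E (arc p) -> exists2 q, crossing L q & a = arc q.
  by rewrite mem_rcons inE => /orP[/eqP->|/Earc//]; exists p.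
have sps' : s < abscissa L p < s' by rewrite sp.
have [|st' [t [search_eq cst' posst' half]]] :=
  @topological_search_crossing (adjacency (rcons E (arc p))) st s s' p
    cp sps' only cst posst.
  by move=> x y; exact: E'arc.
rewrite /= search_eq /=; apply: leq_add.
  by case: halving_crossing half => // ->.
apply: (IH s') => //.
- exact: path_sorted srt.
- move=> q; apply/idP/andP => [qps|[cq s'q]].
    have := psE q; rewrite inE qps orbT => /esym/andP[cq _].
    by split=> //; exact: s'ps.
  have : q \in p :: ps by rewrite psE cq; lra.
  by rewrite inE => /orP[/eqP qp|//]; move: s'q; rewrite qp ltNge (ltW ps').
- move=> q cq; apply/eqP => qs'; have qp : q = p by apply: only => //; rewrite qs'; lra.
  by move: ps'; rewrite -qs' qp ltxx.
Qed.

(** * Sorted crossings, acyclicity and the halving count *)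

Definition sorted_crossings : seq ('I_n * 'I_n) :=
  sort (fun p q => abscissa L p <= abscissa L q) (enum (crossing L)).

Lemma mem_sorted_crossings p : (p \in sorted_crossings) = crossing L p.
Proof. by rewrite mem_sort mem_enum. Qed.

Lemma sorted_crossings_uniq : uniq sorted_crossings.
Proof. by rewrite sort_uniq enum_uniq. Qed.

Lemma sorted_crossings_lt :
  sorted (fun p q => abscissa L p < abscissa L q) sorted_crossings.
Proof.
have : sorted (fun x y => x <= y) (map (abscissa L) sorted_crossings).
  by rewrite sorted_map; apply: sort_sorted => p q; exact: le_total.
move=> srt; have : sorted <%R (map (abscissa L) sorted_crossings).
  rewrite lt_sorted_uniq_le srt andbT map_inj_in_uniq ?sorted_crossings_uniq //.
  by move=> p q; rewrite !mem_sorted_crossings; exact: abscissa_inj.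
by rewrite sorted_map.
Qed.

Lemma exists_below (r : seq R) : exists s, forall x, x \in r -> s < x.
Proof.
elim: r => [|y r [s sr]]; first by exists 0.
exists (Num.min s (y - 1)) => x; rewrite inE gt_min => /orP[/eqP->|/sr->//].
by rewrite ltrBlDr ltrDl ltr01 orbT.
Qed.

(** On a sweep line right of all crossings, each arc goes from a lower line to a higher one, so the
    rank there increases along arcs. *)
Lemma acyclic_crossings (E : seq (V * V)) :
  (forall a, a \in E -> exists2 p, crossing L p & a = arc p) -> acyclic E.
Proof.
(* A lower bound on the negated abscissas puts [- s] right of all crossings. *)
move=> Earc; have [s sX] := exists_below (map (fun p => - abscissa L p) sorted_crossings).
have {}sX p : crossing L p -> abscissa L p < - s.
  rewrite -mem_sorted_crossings => /(map_f (fun p => - abscissa L p))/sX.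
  by rewrite ltrNr.
pose f (x : V) := if insub (val x) is Some i then rank L (- s) i else 0%N.
apply: (@acyclic_pos _ f) => _ _ /Earc[p cp [-> ->]].
rewrite /f !valK; apply: ltn_rank; have [_ _] := crossingP cp; apply; exact: sX.
Qed.

(** A halving point yields a crossing from which the point can be recovered, so this choice is
    injective. *)
Lemma halving_le_count k :
  (halving L #= `I_k)%card -> (k <= count halving_crossing sorted_crossings)%N.
Proof.
rewrite card_eq_sym => /pcard_eqP/bijPex[f [ff finj _]].
have /choice[g gP] (a : 'I_k) : exists p,
    [/\ crossing L p, halving_crossing p & f a = (abscissa L p, L p.1 (abscissa L p))].
  have [[i [j [ij Li Lj]]] half] : halving L (f a) by apply: ff; exact: ltn_ord.
  have [p [cp px pE]] := meet_crossing psL gpL ij (etrans Li (esym Lj)).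
  have Lp : L p.1 (abscissa L p) = (f a).2 by rewrite px; case: pE => ->.
  exists p; split=> //; last by rewrite Lp px -surjective_pairing.
  by apply/eqP; rewrite -half /rank Lp px.
have g_inj : injective g.
  move=> a b gab; have [_ _ fa] := gP a; have [_ _ fb] := gP b.
  apply/val_inj/finj; rewrite ?inE; try exact: ltn_ord.
  by rewrite fa fb gab.
rewrite -size_filter -{1}[k]size_enum_ord -(size_map g).
apply: uniq_leq_size; first by rewrite map_inj_uniq ?enum_uniq.
move=> _ /mapP[a _ ->]; have [ca ha _] := gP a.
by rewrite mem_filter mem_sorted_crossings ca ha.
Qed.

End Run.

Theorem theorem5p7 (R : realType) :
  exists2 c : R, 0 < c &
  forall n : nat, ~~ odd n ->
  exists (pos : 'I_(3 * n %/ 2) -> nat)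
         (arcs : seq ('I_(3 * n %/ 2) * 'I_(3 * n %/ 2))),
    [/\ numbering pos,
        uniq arcs,
        (forall k : nat, acyclic (take k arcs)) &
        (max_halving R n <=
         count (fun t : nat => (c * n%:R <= t%:R)%R)
               (addition_times [::] (initial_state pos) arcs))%N].
Proof.
(* The run guarantees [n <= 2 * t], hence the constant 1/2. *)
exists (1 / 2); first lra.
move=> n even_n.
have [->|[L [psL gpL /(halving_le_count psL gpL) le_max]]] := halving_count_max R n.
  (* If the maximum is 0, any numbering without arcs will do. *)
  exists (fun x => x.+1), [::]; split=> //.
    by apply: inj_numbering => [x y []/ord_inj//|x]; rewrite card_ord ltn_ord.
  by move=> k; apply: (@acyclic_pos _ (fun=> 0)).
(* The sweep starts left of every crossing, so that it meets them all. *)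
have [s sX] := exists_below (map (abscissa L) (sorted_crossings L)).
have {}sX p : crossing L p -> s < abscissa L p.
  by rewrite -mem_sorted_crossings => /(map_f (abscissa L))/sX.
have sgen p : crossing L p -> abscissa L p != s.
  by move=> /sX; rewrite lt_neqAle eq_sym => /andP[].
have nums := sweep_numbering even_n (generic_abscissa psL gpL sgen).
exists (sweep_position L s), (map (arc even_n) (sorted_crossings L)); split=> //.
- by rewrite map_inj_uniq ?sorted_crossings_uniq //; exact: arc_inj.
- move=> k; apply: (acyclic_crossings (L := L) (even_n := even_n)) => a /mem_take/mapP[p].
  by rewrite mem_sorted_crossings => cp ->; exists p.
apply: (leq_trans le_max).
apply: (@leq_trans (count (fun t => n <= 2 * t)%N
  (addition_times [::] (initial_state (sweep_position L s))
     (map (arc even_n) (sorted_crossings L))))).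
  apply: (addition_times_crossings psL gpL (s := s)) => //.
  - exact: sorted_crossings_lt.
  - by move=> p; rewrite mem_sorted_crossings; case cp: crossing; rewrite //= sX.
  - exact: initial_state_consistent.
apply: sub_count => t; rewrite -(ler_nat R) natrM; lra.
Qed.
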